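(* Let $p$ and $q$ be distinct odd primes and $N=pq$, with $N\notin\{15,21,39,55\}$. Suppose there is an elliptic curve over $\mathbb{Q}$ of conductor $N$ having a rational point of order $2$. Then, possibly after interchanging $p$ and $q$, at least one of the following Diophantine equations has an integral solution $(A,a,b)$ with $a,b>0$ (where in each equation the signs $\pm$ may be chosen independently, except as specified in (5)): (1) $1=2^{4}q^{b}-p^{a}$; (2) $|p^{a}-q^{b}|=16$; (3) $A^{2}+64=p^{a}q^{b}$; (4) $A^{2}\pm64q^{b}=\pm p^{a}$; (5) $A^{2}\pm4q^{b}=\pm256p^{a}$ together with $q^{b}\equiv\pm1\pmod 8$, where the sign in this congruence is the opposite of the sign in front of $4q^{b}$; (6) $A^{2}\pm4p^{a}q^{b}=\pm256$; (7) $A^{2}\pm64p^{a}q^{b}=\pm1$. *)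

(* Defs.v *)
From HB Require Import structures.
From mathcomp Require Import all_boot all_order all_fingroup all_algebra all_field.
From mathcomp Require Import boolp.

Set Implicit Arguments.
Unset Strict Implicit.
Unset Printing Implicit Defensive.

Import GRing.Theory.

Local Open Scope ring_scope.

(* Weierstrass equations
     y^2 + w1 x y + w3 y = x^3 + w2 x^2 + w4 x + w6. *)
Record weierstrass (R : Type) :=
  Weierstrass { w1 : R; w2 : R; w3 : R; w4 : R; w6 : R }.

Definition map_weierstrass (R S : Type) (f : R -> S) (W : weierstrass R) :=
  Weierstrass (f (w1 W)) (f (w2 W)) (f (w3 W)) (f (w4 W)) (f (w6 W)).

Definition discriminant (R : comNzRingType) (W : weierstrass R) : R :=
  let b2 := w1 W ^+ 2 + 4 * w2 W in
  let b4 := 2 * w4 W + w1 W * w3 W in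
  let b6 := w3 W ^+ 2 + 4 * w6 W in
  let b8 := w1 W ^+ 2 * w6 W + 4 * w2 W * w6 W - w1 W * w3 W * w4 W
            + w2 W * w3 W ^+ 2 - w4 W ^+ 2 in
  - b2 ^+ 2 * b8 - 8 * b4 ^+ 3 - 27 * b6 ^+ 2 + 9 * b2 * b4 * b6.

Record elliptic_curve (F : fieldType) := EllipticCurve {
  equation :> weierstrass F;
  discriminant_neq0 : discriminant equation != 0 }.

(* [None] is the point at infinity. *)
Definition point (F : Type) := option (F * F).

Definition on_curve (F : fieldType) (W : weierstrass F) (P : point F) : bool :=
  if P is Some (x, y) then
    y ^+ 2 + w1 W * x * y + w3 W * y
      == x ^+ 3 + w2 W * x ^+ 2 + w4 W * x + w6 W
  else true.

(* The chord-tangent law. When x1 = x2 and the points are not opposite they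
   are equal, and the line is the tangent. *)
Definition add_point (F : fieldType) (W : weierstrass F) (P Q : point F) :
    point F :=
  match P, Q with
  | None, _ => Q
  | _, None => P
  | Some (x1, y1), Some (x2, y2) =>
    if (x1 == x2) && (y1 + y2 + w1 W * x2 + w3 W == 0) then None else
    let slope :=
      if x1 == x2 then
        (3 * x1 ^+ 2 + 2 * w2 W * x1 + w4 W - w1 W * y1)
          / (2 * y1 + w1 W * x1 + w3 W)
      else (y2 - y1) / (x2 - x1) in
    let x3 := slope ^+ 2 + w1 W * slope - w2 W - x1 - x2 in
    Some (x3, - (y1 + slope * (x3 - x1)) - w1 W * x3 - w3 W)
  end.

Definition mul_point (F : fieldType) (W : weierstrass F) (n : nat)
  (P : point F) : point F := iter n (add_point W P) None.

Definition has_rational_point_of_order_2 (F : fieldType)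
    (E : elliptic_curve F) : Prop :=
  exists P : point F, [/\ on_curve E P, P <> None & mul_point E 2 P = None].

(* The equation obtained from W by the substitution
   x = u^2 x' + r,  y = u^3 y' + u^2 s x' + t. *)
Definition change_variables (F : fieldType) (u r s t : F) (W : weierstrass F) :
    weierstrass F :=
  Weierstrass
    ((w1 W + 2 * s) / u)
    ((w2 W - s * w1 W + 3 * r - s ^+ 2) / u ^+ 2)
    ((w3 W + r * w1 W + 2 * t) / u ^+ 3)
    ((w4 W - s * w3 W + 2 * r * w2 W - (t + r * s) * w1 W + 3 * r ^+ 2
      - 2 * s * t) / u ^+ 4)
    ((w6 W + r * w4 W + r ^+ 2 * w2 W + r ^+ 3 - t * w3 W - t ^+ 2
      - r * t * w1 W) / u ^+ 6).

Definition isomorphic (F : fieldType) (W W' : weierstrass F) : Prop :=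
  exists u r s t : F, u != 0 /\ W' = change_variables u r s t W.

Definition p_integral (p : nat) (x : rat) : bool := ~~ (p %| `|denq x|)%N.

Definition p_integral_equation (p : nat) (W : weierstrass rat) : bool :=
  [&& p_integral p (w1 W), p_integral p (w2 W), p_integral p (w3 W),
      p_integral p (w4 W) & p_integral p (w6 W)].

(* The p-adic valuation of a nonzero p-integral rational is that of its
   numerator. *)
Definition val_discriminant (p : nat) (W : weierstrass rat) : nat :=
  logn p `|numq (discriminant W)|.

Definition minimal_at (p : nat) (E : elliptic_curve rat) (W : weierstrass rat) :
    Prop :=
  [/\ isomorphic E W, p_integral_equation p W &
      forall W' : weierstrass rat,
        isomorphic E W' -> p_integral_equation p W' ->
        (val_discriminant p W <= val_discriminant p W')%N].

(* [ratr : rat -> 'F_p] divides the image of the numerator by the image of the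
   denominator, hence is the residue map on p-integral rationals. *)
Definition reduction (p : nat) (W : weierstrass rat) : weierstrass 'F_p :=
  map_weierstrass ratr W.

Definition singular_point (F : fieldType) (W : weierstrass F) (x y : F) : Prop :=
  [/\ on_curve W (Some (x, y)),
      w1 W * y - 3 * x ^+ 2 - 2 * w2 W * x - w4 W = 0 &
      2 * y + w1 W * x + w3 W = 0].

(* At a singular point (x, y) the degree 2 part of the equation, in the local
   coordinates X, Y, is Y^2 + w1 X Y - (3 x + w2) X^2; the slopes of the tangent
   lines are the roots of the following polynomial. *)
Definition tangent_poly (F : fieldType) (W : weierstrass F) (x : F) : {poly F} :=
  'X^2 + (w1 W)%:P * 'X - (3 * x + w2 W)%:P.

(* A singular Weierstrass cubic over the perfect field 'F_p has exactly one
   singular point, which is rational. *)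
Definition node (F : fieldType) (W : weierstrass F) : Prop :=
  exists x y : F, singular_point W x y /\ separable_poly (tangent_poly W x).

Definition cusp (F : fieldType) (W : weierstrass F) : Prop :=
  exists x y : F, singular_point W x y /\ ~~ separable_poly (tangent_poly W x).

Definition good_reduction (p : nat) (W : weierstrass rat) : Prop :=
  discriminant (reduction p W) != 0.

Definition multiplicative_reduction (p : nat) (W : weierstrass rat) : Prop :=
  node (reduction p W).

Definition additive_reduction (p : nat) (W : weierstrass rat) : Prop :=
  cusp (reduction p W).

(* The wild part of the conductor exponent at p is
     delta = \sum_(i >= 1) #|G_i| / #|G_0| * dim (E[l] / E[l]^G_i)
   for any prime l != p, where G_i is the i-th ramification group (lower
   numbering) of Q_p(E[l]) / Q_p. The groups G_i, i >= 0, are computed in the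
   number field L = Q(E[l]), at a prime P above p. *)
Section WildPart.

Variable L : splittingFieldType rat.

Definition integral (x : L) : Prop := integralOver (intr : int -> L) x.

Record prime_above (p : nat) (P : L -> Prop) : Prop := PrimeAbove {
  prime_above_integral : forall x, P x -> integral x;
  prime_above0 : P 0;
  prime_aboveD : forall x y, P x -> P y -> P (x + y);
  prime_aboveM : forall x y, integral x -> P y -> P (x * y);
  prime_above1 : ~ P 1;
  prime_above_prime : forall x y,
    integral x -> integral y -> P (x * y) -> P x \/ P y;
  prime_above_char : P p%:R }.

Fixpoint ideal_exp (P : L -> Prop) (n : nat) : L -> Prop :=
  if n is m.+1 then fun x : L =>
    exists2 c : seq (L * L),
      (forall t, t \in c -> P t.1 /\ ideal_exp P m t.2) &
      x = \sum_(t <- c) t.1 * t.2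
  else integral.

Definition ramification_group (P : L -> Prop) (i : nat) :
    {set gal_of {: L}} :=
  [set g in 'Gal({: L} / 1)%g |
    `[< forall x, integral x -> ideal_exp P i.+1 (g x - x) >]].

Definition gal_point (g : gal_of {: L}) : point L -> point L :=
  omap (fun P : L * L => (g P.1, g P.2)).

Definition coordinates (P : point L) : seq L :=
  if P is Some (x, y) then [:: x; y] else [::].

(* T lists the l-torsion points over an algebraic closure (there are l^2 of
   them), and their coordinates generate L. *)
Definition torsion_list (E : elliptic_curve rat) (l : nat)
    (T : seq (point L)) : Prop :=
  let EL := map_weierstrass (in_alg L) E in
  [/\ uniq T, size T = (l ^ 2)%N,
      forall P, P \in T -> on_curve EL P /\ mul_point EL l P = None &
      (<<1 & flatten (map coordinates T)>> = {: L})%VS].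

(* dim (E[l] / E[l]^G) *)
Definition codim_fixed (l : nat) (T : seq (point L))
    (G : {set gal_of {: L}}) : nat :=
  2 - logn l (count (fun P => [forall g in G, gal_point g P == P]) T).

End WildPart.

(* The sum is truncated at some n beyond which the ramification groups are
   trivial, and denominators are cleared. *)
Definition wild_exponent (p : nat) (E : elliptic_curve rat) (delta : nat) :
    Prop :=
  exists (l : nat) (L : splittingFieldType rat) (T : seq (point L))
         (P : L -> Prop) (n : nat),
    [/\ prime l /\ l <> p, torsion_list E l T, prime_above p P,
        forall i, (n <= i)%N -> ramification_group P i = [set 1%g] &
        (delta * #|ramification_group P 0|
         = \sum_(1 <= i < n) #|ramification_group P i|
             * codim_fixed l T (ramification_group P i))%N].

Definition conductor_exponent (p : nat) (E : elliptic_curve rat) (f : nat) :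
    Prop :=
  exists2 W : weierstrass rat, minimal_at p E W &
    [\/ good_reduction p W /\ f = 0%N,
        multiplicative_reduction p W /\ f = 1%N |
        additive_reduction p W /\
          exists2 delta, wild_exponent p E delta & f = (2 + delta)%N].

Definition is_conductor (E : elliptic_curve rat) (N : nat) : Prop :=
  (0 < N)%N /\ forall p, prime p -> conductor_exponent p E (logn p N).

(* Signs are written (-1)^s and (-1)^t with s, t : bool. *)
Definition equation_solvable (p q : nat) : Prop :=
  let p := p%:Z in let q := q%:Z in
  exists (A : int) (a b : nat), (0 < a)%N /\ (0 < b)%N /\
    (1 = 2 ^+ 4 * q ^+ b - p ^+ a
    \/ `|p ^+ a - q ^+ b| = 16
    \/ A ^+ 2 + 64 = p ^+ a * q ^+ b
    \/ (exists s t : bool,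
          A ^+ 2 + (-1) ^+ s * (64 * q ^+ b) = (-1) ^+ t * p ^+ a)
    \/ (exists s t : bool,
          A ^+ 2 + (-1) ^+ s * (4 * q ^+ b) = (-1) ^+ t * (256 * p ^+ a) /\
          (q ^+ b = - (-1) ^+ s %[mod 8])%Z)
    \/ (exists s t : bool,
          A ^+ 2 + (-1) ^+ s * (4 * p ^+ a * q ^+ b) = (-1) ^+ t * 256)
    \/ (exists s t : bool,
          A ^+ 2 + (-1) ^+ s * (64 * p ^+ a * q ^+ b) = (-1) ^+ t)).

(* Main.v *)
(* Moving the rational point of order 2 to the origin puts the curve in the form
   Y^2 = X^3 + A X^2 + B X with A, B integers such that no prime l has l^2 | A
   and l^4 | B. At every prime l, comparison with an l-minimal equation shows
   that, up to l-units, B^2 (A^2 - 4 B) = 2^8 Delta and A^2 - 3 B = c4. So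
   B^2 (A^2 - 4 B) has no prime divisors besides 2, p and q, and since c4 is
   prime to pq, each of p and q divides exactly one of B and A^2 - 4 B. At 2,
   good reduction leaves only the valuations (0, 8) and (4, 0) for
   (B, A^2 - 4 B), and in both cases one gets A'^2 - X = 64 Y, where each of p
   and q divides exactly one of X and Y, which have no other prime divisors.
   The distribution of p and q among X and Y yields equations (3), (4), (7), or
   A'^2 - 64 = +- p^a q^b. In the last case the factors A' - 8 and A' + 8 are
   coprime, which gives (2), except for A' <= 9 where N = 15, 21, 39 or 55. *)
Require Import Defs.
From HB Require Import structures.
From mathcomp Require Import all_boot all_order all_fingroup all_algebra all_field.
From mathcomp Require Import boolp.
From mathcomp Require Import ring lra zify.

Set Implicit Arguments.
Unset Strict Implicit.
Unset Printing Implicit Defensive.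

Import Order.TTheory GRing.Theory Num.Theory.

Local Open Scope ring_scope.

(** * Localization of the rationals at a prime *)

Section LocalRing.

Variables (l : nat) (l_prime : prime l).

Let l_neq0 : l%:R != 0 :> rat.
Proof. by rewrite pnatr_eq0 -lt0n prime_gt0. Qed.

Lemma p_integral_frac (m n : int) :
  ~~ (l %| `|n|)%N -> p_integral l (m%:~R / n%:~R).
Proof.
move=> ln; have n0 : n%:~R != 0 :> rat.
  by rewrite intr_eq0; apply: contraNneq ln => ->.
set x := _ / _; apply: contra ln => /dvdn_trans; apply.
have /intr_inj e : (numq x * n)%:~R = (m * denq x)%:~R :> rat.
  by rewrite !rmorphM /= numqE -mulrA [_ * n%:~R]mulrC mulrA divfK.
rewrite -(Gauss_dvdr _ (_ : coprime _ `|numq x|)); last first.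
  by rewrite coprime_sym coprime_num_den.
by rewrite -abszM e abszM dvdn_mull.
Qed.

Lemma p_integralP (x : rat) :
  reflect (exists m n : int, ~~ (l %| `|n|)%N /\ x = m%:~R / n%:~R)
          (p_integral l x).
Proof.
apply: (iffP idP) => [lx|[m [n [ln ->]]]]; last exact: p_integral_frac.
by exists (numq x), (denq x); rewrite divq_num_den.
Qed.

Lemma not_dvdn_intr_neq0 (R : numDomainType) (n : int) :
  ~~ (l %| `|n|)%N -> n%:~R != 0 :> R.
Proof. by move=> ln; rewrite intr_eq0; apply: contraNneq ln => ->. Qed.

Lemma not_dvdnM (m n : int) :
  ~~ (l %| `|m|)%N -> ~~ (l %| `|n|)%N -> ~~ (l %| `|(m * n)%R|)%N.
Proof. by move=> lm ln; rewrite abszM Euclid_dvdM // negb_or lm. Qed.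

Fact p_integral_subring : subring_closed (p_integral l).
Proof.
split.
- by rewrite /p_integral unfold_in /= dvdn1; case: l l_prime => [|[]].
- move=> _ _ /p_integralP[m [n [ln ->]]] /p_integralP[m' [n' [ln' ->]]].
  apply/p_integralP; exists (m * n' - m' * n), (n * n'); split.
    exact: not_dvdnM.
  have := not_dvdn_intr_neq0 rat ln; have := not_dvdn_intr_neq0 rat ln'.
  by move=> ? ?; rewrite rmorphB !rmorphM /=; field; apply/andP.
- move=> _ _ /p_integralP[m [n [ln ->]]] /p_integralP[m' [n' [ln' ->]]].
  apply/p_integralP; exists (m * m'), (n * n'); split; first exact: not_dvdnM.
  by rewrite !rmorphM invfM /= mulrACA.
Qed.

(** The localization of the integers at [l]. Primality is an argument so that the predicate can
    carry a subring structure, closure under products depending on it. *)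
Definition local_ring of prime l : {pred rat} := p_integral l.

HB.instance Definition _ :=
  GRing.isSubringClosed.Build rat (local_ring l_prime) p_integral_subring.

Notation Zl := (local_ring l_prime).

Lemma local_ring_dvd (m : int) n :
  (m%:~R / l%:R ^+ n \in Zl) = (l%:Z ^+ n %| m)%Z.
Proof.
apply/idP/idP => [|/dvdzP[k ->]]; last first.
  by rewrite rmorphM rmorphXn /= mulfK ?expf_neq0 // rpred_int.
rewrite /local_ring unfold_in => lx; set x := _ / _ in lx.
have /intr_inj e : (numq x * l%:Z ^+ n)%:~R = (m * denq x)%:~R :> rat.
  rewrite !rmorphM rmorphXn /= numqE -mulrA [_ * l%:R ^+ n]mulrC mulrA.
  by rewrite divfK // expf_neq0.
rewrite -(@Gauss_dvdzl _ _ (denq x)) -?e ?dvdz_mull //.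
by rewrite coprimezE abszX coprimeXl // prime_coprime.
Qed.

Lemma local_ring_unitE (n : int) :
  n != 0 -> (n%:~R^-1 \in Zl) = ~~ (l %| n)%Z.
Proof.
move=> n0; rewrite /local_ring unfold_in; apply/idP/idP => [|ln].
  by rewrite /p_integral denqVz.
by rewrite -div1r -[1]/(1%:~R); apply: p_integral_frac.
Qed.

Lemma local_ring_prime_inv : l%:R^-1 \notin Zl.
Proof.
have -> : l%:R^-1 = (l : int)%:~R^-1 :> rat by [].
by rewrite local_ring_unitE ?dvdzz //; rewrite eqz_nat -lt0n prime_gt0.
Qed.

(** Stands in for the [l]-adic valuation of [u]: the cases are positive, negative and zero
    valuation. *)
Lemma local_ring_cases (u : rat) : u != 0 ->
  [\/ u / l%:R \in Zl, u^-1 / l%:R \in Zl | u \in Zl /\ u^-1 \in Zl].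
Proof.
move=> u0; have nu0 : numq u != 0 by rewrite numq_eq0.
have [/dvdnP[k num_u]|lnum] := boolP (l %| `|numq u|)%N.
  constructor 1; apply/p_integralP; exists (sgz (numq u) * k), (denq u).
  split.
    by rewrite -prime_coprime // (coprime_dvdl _ (coprime_num_den u)) // num_u
      dvdn_mull.
  rewrite -{1}(divq_num_den u) {1}[numq u]intEsg num_u.
  rewrite !rmorphM /= mulrAC; congr (_ / _).
  by rewrite mulrA mulfK.
have [/dvdnP[k den_u]|lden] := boolP (l %| `|denq u|)%N.
  constructor 2; apply/p_integralP; exists k, (numq u); split=> //.
  rewrite -{1}(divq_num_den u) invf_div.
  rewrite -absz_denq den_u PoszM rmorphM /= mulrAC; congr (_ / _).
  by rewrite mulfK.
constructor 3; split; apply/p_integralP.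
  by exists (numq u), (denq u); rewrite divq_num_den.
by exists (denq u), (numq u); rewrite -invf_div divq_num_den.
Qed.

Lemma intr_Fp_eq0 (n : int) : (n%:~R == 0 :> 'F_l) = (l %| `|n|)%N.
Proof. by rewrite -(dvdz_pcharf (pchar_Fp l_prime)). Qed.

(** The fraction need not be in lowest terms, so residues of sums and products can be read off their
    unreduced fractions. *)
Lemma ratr_Fp_frac (m n : int) :
  ~~ (l %| `|n|)%N -> ratr (m%:~R / n%:~R) = m%:~R / n%:~R :> 'F_l.
Proof.
move=> ln; have n0 := not_dvdn_intr_neq0 rat ln.
have := p_integral_frac m ln; set x := _ / _ => lx.
have /intr_inj e : (numq x * n)%:~R = (m * denq x)%:~R :> rat.
  by rewrite !rmorphM /= numqE -mulrA [_ * n%:~R]mulrC mulrA divfK.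
move: lx ln; rewrite /p_integral -!intr_Fp_eq0 => ldx ln.
by apply/eqP; rewrite /ratr eqr_div // -!intrM e.
Qed.

(** [ratr] respects the ring operations only on [l]-integral rationals. Carrying integrality along
    with the value lets residues be computed by following the syntax of an expression. *)
Definition residue (x : rat) (y : 'F_l) : Prop := x \in Zl /\ ratr x = y.

Lemma residue_ratr x : x \in Zl -> residue x (ratr x).
Proof. by []. Qed.

Lemma residue_nat n : residue n%:R n%:R.
Proof. by split; rewrite ?rpred_nat ?ratr_nat. Qed.

Lemma residueN x y : residue x y -> residue (- x) (- y).
Proof.
case=> /[dup] /p_integralP[m [n [ln ->]]] xl <-; split; first by rewrite rpredN.
by rewrite -mulNr -rmorphN !ratr_Fp_frac // rmorphN mulNr.
Qed.

Lemma residueD x x' y y' : residue x y -> residue x' y' ->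
  residue (x + x') (y + y').
Proof.
case=> /[dup] /p_integralP[m [n [ln ->]]] xl <-.
case=> /[dup] /p_integralP[m' [n' [ln' ->]]] xl' <-; split.
  exact: rpredD.
have [n0 n0'] := (not_dvdn_intr_neq0 rat ln, not_dvdn_intr_neq0 rat ln').
rewrite addf_div // -!(rmorphM, rmorphD) !ratr_Fp_frac ?not_dvdnM //.
by rewrite addf_div ?intr_Fp_eq0 // -!(rmorphM, rmorphD).
Qed.

Lemma residueM x x' y y' : residue x y -> residue x' y' ->
  residue (x * x') (y * y').
Proof.
case=> /[dup] /p_integralP[m [n [ln ->]]] xl <-.
case=> /[dup] /p_integralP[m' [n' [ln' ->]]] xl' <-; split.
  exact: rpredM.
by rewrite mulf_div -!rmorphM !ratr_Fp_frac ?not_dvdnM // mulf_div -!rmorphM.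
Qed.

Lemma residueX n x y : residue x y -> residue (x ^+ n) (y ^+ n).
Proof.
move=> xy; elim: n => [|n IHn]; first exact: (residue_nat 1).
by rewrite !exprS; apply: residueM.
Qed.

Lemma residue_unit x y : residue x y -> y != 0 -> x != 0 /\ x^-1 \in Zl.
Proof.
case=> /p_integralP[m [n [ln ->]]] <-; rewrite ratr_Fp_frac // mulf_eq0.
rewrite negb_or intr_Fp_eq0 => /andP[lm _].
split; first by rewrite mulf_neq0 ?invr_neq0 ?not_dvdn_intr_neq0.
by apply/p_integralP; exists n, m; rewrite invf_div.
Qed.

Lemma residue0_div x : residue x 0 -> x / l%:R \in Zl.
Proof.
case=> /p_integralP[m [n [ln ->]]]; rewrite ratr_Fp_frac // => /eqP.
rewrite mulf_eq0 invr_eq0 !intr_Fp_eq0 (negPf ln) orbF => lm.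
rewrite mulrAC rpredM //.
  by have := local_ring_dvd m 1; rewrite !expr1 dvdzE /= lm.
have n0 := not_dvdn_intr_neq0 int ln.
by rewrite local_ring_unitE // -[n]intz.
Qed.

End LocalRing.

(** * Weierstrass equations with a point of order 2 *)

Section Weierstrass.

Variable R : comNzRingType.
Implicit Types W : weierstrass R.

Definition b2 W := w1 W ^+ 2 + 4 * w2 W.
Definition b4 W := 2 * w4 W + w1 W * w3 W.
Definition b6 W := w3 W ^+ 2 + 4 * w6 W.
Definition c4 W := b2 W ^+ 2 - 24 * b4 W.

(** The 2-division polynomial, equal to [(2 y + w1 x + w3)^2] on the curve. *)
Definition order2_abscissa W (x : R) :=
  4 * x ^+ 3 + b2 W * x ^+ 2 + 2 * b4 W * x + b6 W = 0.

(* When x is the abscissa of a point of order 2, moving that point to the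
   origin turns W, up to scaling, into Y^2 = X^3 + alpha X^2 + beta X. *)
Definition alpha W x := b2 W + 12 * x.
Definition beta W x := 48 * x ^+ 2 + 8 * b2 W * x + 8 * b4 W.

Lemma c4_alpha_beta W x : alpha W x ^+ 2 - 3 * beta W x = c4 W.
Proof. by rewrite /alpha /beta /c4; ring. Qed.

(** The curve [Y^2 = X^3 + alpha X^2 + beta X] has discriminant [16 beta^2 (alpha^2 - 4 beta)];
    passing to it from [W] scales x by 4, hence the discriminant by [2^12]. *)
Lemma discriminant_alpha_beta W x : order2_abscissa W x ->
  beta W x ^+ 2 * (alpha W x ^+ 2 - 4 * beta W x) = 2 ^+ 8 * discriminant W.
Proof.
(* The relation [4 b8 = b2 b6 - b4^2] eliminates [b8]; the equation for [x] then eliminates [b6]. *)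
have -> : 2 ^+ 8 * discriminant W =
    64 * (- b2 W ^+ 2 * (b2 W * b6 W - b4 W ^+ 2)
          + 4 * (- 8 * b4 W ^+ 3 - 27 * b6 W ^+ 2 + 9 * b2 W * b4 W * b6 W)).
  by rewrite /discriminant /b2 /b4 /b6; ring.
move=> /eqP; rewrite addrC addr_eq0 => /eqP ->.
by rewrite /alpha /beta; ring.
Qed.

End Weierstrass.

Section WeierstrassField.

Variable F : fieldType.
Implicit Types W : weierstrass F.

Lemma order2_abscissa_exists (E : elliptic_curve F) :
  has_rational_point_of_order_2 E -> exists x, order2_abscissa E x.
Proof.
(* Doubling an affine point gives infinity only through the first test of [add_point], that is when
   [2 y + w1 x + w3] vanishes. *)
case=> -[[x y]|] [] //= /eqP onE _; rewrite eqxx /=.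
case: eqP => // e _; exists x.
have {}e : 2 * y + w1 E * x + w3 E = 0 by rewrite -e; ring.
rewrite /order2_abscissa.
have -> : 4 * x ^+ 3 + b2 E * x ^+ 2 + 2 * b4 E * x + b6 E =
    (2 * y + w1 E * x + w3 E) ^+ 2
    - 4 * (y ^+ 2 + w1 E * x * y + w3 E * y
           - (x ^+ 3 + w2 E * x ^+ 2 + w4 E * x + w6 E)).
  by rewrite /b2 /b4 /b6; ring.
by rewrite onE subrr e; ring.
Qed.

Lemma change_variables_order2 u r s t W x : u != 0 -> order2_abscissa W x ->
  exists x', let W' := change_variables u r s t W in
    [/\ order2_abscissa W' x', alpha W x = u ^+ 2 * alpha W' x'
      & beta W x = u ^+ 4 * beta W' x'].
Proof.
move=> u0 Wx; exists ((x - r) / u ^+ 2); split.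
- apply: (mulfI (expf_neq0 6 u0)); rewrite mulr0 -[RHS]Wx.
  by rewrite /b2 /b4 /b6 /=; field.
- by rewrite /alpha /b2 /=; field.
- by rewrite /beta /b2 /b4 /=; field.
Qed.

(** The singularity conditions determine [w3], [w4] and [w6] from the rest, leaving polynomial
    identities. The quantity squared is the discriminant of [tangent_poly W x], so [c4] tells nodes
    from cusps. *)
Lemma singular_discriminant_c4 W x y : singular_point W x y ->
  discriminant W = 0 /\ c4 W = (w1 W ^+ 2 + 4 * (3 * x + w2 W)) ^+ 2.
Proof.
case: W => a1 a2 a3 a4 a6; rewrite /singular_point /c4 /b2 /b4 /discriminant /=.
case=> /eqP e6 e4 e3.
have {}e3 : a3 = - (2 * y + a1 * x) by apply/eqP; rewrite -addr_eq0 addrC e3.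
have {}e4 : a4 = a1 * y - 3 * x ^+ 2 - 2 * a2 * x.
  by apply/esym/eqP; rewrite -subr_eq0 e4.
have {}e6 : a6 = y ^+ 2 + a1 * x * y + a3 * y - (x ^+ 3 + a2 * x ^+ 2 + a4 * x).
  by rewrite e6; ring.
by rewrite e6 e4 e3; split; ring.
Qed.

Lemma separable_tangent_poly W x : 2 != 0 :> F ->
  separable_poly (tangent_poly W x) -> w1 W ^+ 2 + 4 * (3 * x + w2 W) != 0.
Proof.
move=> two0; apply: contraTneq => D0.
(* A monic quadratic with zero discriminant has a double root at minus half its linear
   coefficient. *)
have root0 : root (tangent_poly W x) (- (w1 W / 2)).
  apply/eqP; rewrite /tangent_poly !hornerE.
  apply: (mulfI (_ : 4 != 0 :> F)).
    by rewrite (natrM _ 2 2) mulf_neq0.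
  by rewrite mulr0 -[RHS]oppr0 -[in RHS]D0; field.
have root1 : root (tangent_poly W x)^`() (- (w1 W / 2)).
  by apply/eqP; rewrite /tangent_poly !(derivE, hornerE); field.
rewrite separable_poly.unlock; apply/negP => /coprimep_root/(_ root0).
by rewrite -rootE root1.
Qed.

Lemma node_discriminant W : node W -> discriminant W = 0.
Proof. by case=> x [y [/singular_discriminant_c4[]]]. Qed.

Lemma node_c4 W : 2 != 0 :> F -> node W -> c4 W != 0.
Proof.
move=> two0 [x [y [/singular_discriminant_c4[_ ->] sep]]].
by rewrite expf_neq0 // separable_tangent_poly.
Qed.

End WeierstrassField.

(* Matching on the goal keeps the unifier from unfolding rational arithmetic. *)
Ltac local := repeat lazymatch goal with
  | H : is_true (?x \in _) |- is_true (?x \in _) => exact: H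
  | |- is_true (_ + _ \in _) => apply: rpredD
  | |- is_true (- _ \in _) => rewrite rpredN
  | |- is_true (_ * _ \in _) => apply: rpredM
  | |- is_true (_ ^+ _ \in _) => apply: rpredX
  | |- is_true (_%:R \in _) => exact: rpred_nat
  end.

(** * Integrality and reduction of Weierstrass equations at a prime *)

Section LocalWeierstrass.

Variables (l : nat) (l_prime : prime l).
Notation Zl := (local_ring l_prime).

Let l_neq0 : l%:R != 0 :> rat.
Proof. by rewrite pnatr_eq0 -lt0n prime_gt0. Qed.

(** An instance of the local ring being integrally closed: if [l] divided [1/x], dividing the
    equation by [x^3] would make [1/l] integral. *)
Lemma local_ring_root_cubic (a b c x : rat) :
  a \in Zl -> b \in Zl -> c \in Zl ->
  x ^+ 3 + a * x ^+ 2 + b * x + c = 0 -> x \in Zl.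
Proof.
move=> la lb lc x_root; have [->|x0] := eqVneq x 0; first exact: rpred0.
case: (local_ring_cases l_prime x0) => [lx|lx|[]//].
  by rewrite -[x](divfK l_neq0) rpredM ?rpred_nat.
have lxi : x^-1 \in Zl by rewrite -[x^-1](divfK l_neq0) rpredM ?rpred_nat.
case/negP: (local_ring_prime_inv l_prime).
have -> : l%:R^-1 = - (a + b * x^-1 + c * x^-1 ^+ 2) * (x^-1 / l%:R).
  apply: (mulfI (expf_neq0 3 x0)).
  have {}x_root : x ^+ 3 = - (a * x ^+ 2 + b * x + c).
    by apply/eqP; rewrite -addr_eq0 -x_root !addrA.
  by rewrite {1}x_root; field; rewrite l_neq0.
local.
Qed.

Lemma local_coefficients W : p_integral_equation l W ->
  [/\ w1 W \in Zl, w2 W \in Zl, w3 W \in Zl, w4 W \in Zl & w6 W \in Zl].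
Proof. by case/and5P; split. Qed.

(** At 2 the abscissa [x] need not be integral, but [4 x] is a root of a monic integral cubic, and
    [alpha] and [beta] are integral polynomials in [4 x]. *)
Lemma local_alpha_beta W x : p_integral_equation l W -> order2_abscissa W x ->
  alpha W x \in Zl /\ beta W x \in Zl.
Proof.
case/local_coefficients=> l1 l2 l3 l4 l6 Wx.
have lb2 : b2 W \in Zl by rewrite /b2; local.
have lb4 : b4 W \in Zl by rewrite /b4; local.
have lb6 : b6 W \in Zl by rewrite /b6; local.
have lx : 4 * x \in Zl.
  apply: (@local_ring_root_cubic (b2 W) (8 * b4 W) (16 * b6 W)) => //;
    rewrite ?rpredM ?rpred_nat //.
  by rewrite -[RHS](mulr0 16) -Wx; ring.
have -> : alpha W x = b2 W + 3 * (4 * x) by rewrite /alpha; ring.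
have -> : beta W x = 3 * (4 * x) ^+ 2 + 2 * b2 W * (4 * x) + 8 * b4 W.
  by rewrite /beta; ring.
by split; local.
Qed.

Ltac residue := repeat lazymatch goal with
  | |- residue _ (_ + _) _ => apply: residueD
  | |- residue _ (- _) _ => apply: residueN
  | |- residue _ (_ * _) _ => apply: residueM
  | |- residue _ (_ ^+ _) _ => apply: residueX
  | |- residue _ _%:R _ => exact: residue_nat
  | |- residue _ _ _ => exact: residue_ratr
  end.

Lemma residue_discriminant W : p_integral_equation l W ->
  residue l_prime (discriminant W) (discriminant (reduction l W)).
Proof.
case/local_coefficients=> l1 l2 l3 l4 l6; rewrite /discriminant /=.
by residue.
Qed.

Lemma residue_c4 W : p_integral_equation l W ->
  residue l_prime (c4 W) (c4 (reduction l W)).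
Proof.
case/local_coefficients=> l1 l2 l3 l4 _; rewrite /c4 /b2 /b4 /=.
by residue.
Qed.

Lemma good_reduction_unit W : p_integral_equation l W -> good_reduction l W ->
  discriminant W != 0 /\ (discriminant W)^-1 \in Zl.
Proof. by move=> Wl; apply: residue_unit; apply: residue_discriminant. Qed.

Lemma multiplicative_reduction_local W : odd l -> p_integral_equation l W ->
  multiplicative_reduction l W ->
  discriminant W / l%:R \in Zl /\ (c4 W != 0 /\ (c4 W)^-1 \in Zl).
Proof.
move=> l_odd Wl W_node; have two0 : 2 != 0 :> 'F_l.
  rewrite (intr_Fp_eq0 l_prime 2) /= dvdn_prime2 //.
  by apply: contraTneq l_odd => ->.
split; last exact: residue_unit (residue_c4 Wl) (node_c4 two0 W_node).
by apply: residue0_div; rewrite -(node_discriminant W_node);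
  apply: residue_discriminant.
Qed.

(* If w1 is even then 8 divides c4, and otherwise c4 is odd. *)
Lemma local_c4_mod8 W : l = 2 -> p_integral_equation l W ->
  c4 W / 4 \in Zl -> c4 W / 8 \in Zl.
Proof.
move=> l2; have lE : l%:R = 2 :> rat by rewrite l2.
case/local_coefficients=> l1 l2' l3 l4 _ lc4.
have c4E : c4 W = w1 W ^+ 4 + 8 * (w1 W ^+ 2 * w2 W + 2 * w2 W ^+ 2
                                   - 6 * w4 W - 3 * w1 W * w3 W).
  by rewrite /c4 /b2 /b4; ring.
set r := (_ - _) in c4E.
have lr : r \in Zl by rewrite /r; local.
have [w0|w0] := eqVneq (w1 W) 0.
  by rewrite c4E w0 expr0n add0r mulrC mulKf.
case: (local_ring_cases l_prime w0) => [lw|lw|[_ lw]].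
- rewrite lE in lw; have -> : c4 W / 8 = 2 * (w1 W / 2) ^+ 4 + r.
    by rewrite c4E; field.
  by local.
- case/negP: (local_ring_prime_inv l_prime).
  by rewrite -[_^-1](mulVKf w0) rpredM.
- case/negP: (local_ring_prime_inv l_prime).
  have -> : l%:R^-1 = 2 * ((c4 W / 4 - 2 * r) * (w1 W)^-1 ^+ 4).
    by rewrite c4E lE; field.
  by local.
Qed.

End LocalWeierstrass.

(** * Integral models *)

(** No prime scaling [(A, B) -> (A / l^2, B / l^4)] of [Y^2 = X^3 + A X^2 + B X] keeps the
    coefficients integral. *)
Definition minimal_pair (A B : int) :=
  forall l, prime l -> ~~ ((l%:Z ^+ 2 %| A)%Z && (l%:Z ^+ 4 %| B)%Z).

Lemma minimal_pair_exists (A B : int) : B != 0 ->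
  exists d A' B' : int,
    [/\ d != 0, A = d ^+ 2 * A', B = d ^+ 4 * B' & minimal_pair A' B'].
Proof.
(* Each division by [l^4] strictly decreases the absolute value of [B], since [B] is nonzero. *)
have [n] := ubnP `|B|%N; elim: n => // n IHn in A B * => leBn B0.
have [AB_min|/existsNP[l /not_implyP[l_prime /negP]]] :=
  EM (minimal_pair A B).
  by exists 1, A, B; rewrite !expr1n !mul1r.
rewrite negbK => /andP[/dvdzP[A1 A_eq] /dvdzP[B1 B_eq]].
have l0 : l%:Z != 0 by rewrite -lt0n prime_gt0.
have B10 : B1 != 0 by apply: contraNneq B0 => B10; rewrite B_eq B10 mul0r.
have ltB : (`|B1| < n)%N.
  rewrite -ltnS (leq_trans _ leBn) // ltnS B_eq abszM abszX /= ltn_Pmulr //.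
    by rewrite -(exp1n 4) ltn_exp2r ?prime_gt1.
  by rewrite absz_gt0.
have [d [A' [B' [d0 A1_eq B1_eq AB_min]]]] := IHn A1 B1 ltB B10.
exists (d * l%:Z), A', B'; split=> //; first by rewrite mulf_neq0.
  by rewrite A_eq A1_eq; ring.
by rewrite B_eq B1_eq; ring.
Qed.

Lemma rat_minimal_pair (a b : rat) : b != 0 ->
  exists (u : rat) (A B : int), [/\ u != 0, A%:~R = u ^+ 2 * a,
    B%:~R = u ^+ 4 * b & minimal_pair A B].
Proof.
move=> b0; set m := denq a; set n := denq b.
have [m0 n0] : m%:~R != 0 :> rat /\ n%:~R != 0 :> rat.
  by rewrite !intr_eq0 !denq_neq0.
(* These are [(m n)^2 a] and [(m n)^4 b], with the denominators cleared. *)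
pose A := m * n ^+ 2 * numq a; pose B := m ^+ 4 * n ^+ 3 * numq b.
have A_eq : A%:~R = (m%:~R * n%:~R) ^+ 2 * a.
  by rewrite /A !(rmorphXn, rmorphM) /= numqE; ring.
have B_eq : B%:~R = (m%:~R * n%:~R) ^+ 4 * b.
  by rewrite /B !(rmorphXn, rmorphM) /= numqE; ring.
have B0 : B != 0.
  by rewrite -(intr_eq0 rat) B_eq mulf_neq0 ?expf_neq0 // mulf_neq0.
have [d [A' [B' [d0 A_d B_d AB_min]]]] := minimal_pair_exists A B0.
have d0' : d%:~R != 0 :> rat by rewrite intr_eq0.
exists (m%:~R * n%:~R / d%:~R), A', B'; split=> //.
- by rewrite !mulf_neq0 ?invr_neq0.
- apply: (mulfI (expf_neq0 2 d0')); rewrite -rmorphXn -rmorphM /= -A_d A_eq.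
  by field.
- apply: (mulfI (expf_neq0 4 d0')); rewrite -rmorphXn -rmorphM /= -B_d B_eq.
  by field.
Qed.

(** * Comparison of a minimal pair with an integral equation at one prime *)

Section LocalModel.

Variables (l : nat) (l_prime : prime l).
Notation Zl := (local_ring l_prime).

Variables (W : weierstrass rat) (x u : rat) (A B : int).
Hypotheses (Wl : p_integral_equation l W) (Wx : order2_abscissa W x).
Hypotheses (u_neq0 : u != 0) (A_eq : A%:~R = u ^+ 2 * alpha W x).
Hypotheses (B_eq : B%:~R = u ^+ 4 * beta W x) (AB_min : minimal_pair A B).

Local Notation D := (B ^+ 2 * (A ^+ 2 - 4 * B)).
Local Notation C := (A ^+ 2 - 3 * B).

Let l_neq0 : l%:R != 0 :> rat.
Proof. by rewrite pnatr_eq0 -lt0n prime_gt0. Qed.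

Let D_eq : D%:~R = u ^+ 12 * (2 ^+ 8 * discriminant W).
Proof.
have -> : D%:~R = B%:~R ^+ 2 * (A%:~R ^+ 2 - 4 * B%:~R) :> rat by ring.
rewrite -(discriminant_alpha_beta Wx) A_eq B_eq.
by move: (alpha W x) (beta W x) => a b; ring.
Qed.

Let C_eq : C%:~R = u ^+ 4 * c4 W.
Proof.
have -> : C%:~R = A%:~R ^+ 2 - 3 * B%:~R :> rat by ring.
rewrite -(c4_alpha_beta W x) A_eq B_eq.
by move: (alpha W x) (beta W x) => a b; ring.
Qed.

(** If [l] divided [u], the pair [(A, B)] would not be minimal; if [l] divided [1/u], then [alpha]
    and [beta] would be divisible by [l^2] and [l^4], which the premise excludes. *)
Let scaling_unit :
  (forall y z : rat, y \in Zl -> z \in Zl -> alpha W x = l%:R ^+ 2 * y ->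
     beta W x = l%:R ^+ 4 * z -> False) ->
  u \in Zl /\ u^-1 \in Zl.
Proof.
move=> not_div; case: (local_ring_cases l_prime u_neq0) => [lu|lu|//].
- have [la lb] := local_alpha_beta l_prime Wl Wx.
  case/negP: (AB_min l_prime); rewrite -!(local_ring_dvd l_prime).
  have -> : A%:~R / l%:R ^+ 2 = (u / l%:R) ^+ 2 * alpha W x.
    by rewrite A_eq; move: (alpha W x) => a; field.
  have -> : B%:~R / l%:R ^+ 4 = (u / l%:R) ^+ 4 * beta W x.
    by rewrite B_eq; move: (beta W x) => b; field.
  by apply/andP; split; local.
- case: (not_div ((u^-1 / l%:R) ^+ 2 * A%:~R) ((u^-1 / l%:R) ^+ 4 * B%:~R)).
  + by rewrite rpredM ?rpredX ?rpred_int.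
  + by rewrite rpredM ?rpredX ?rpred_int.
  + by rewrite A_eq; move: (alpha W x) => a; field; rewrite l_neq0.
  + by rewrite B_eq; move: (beta W x) => b; field; rewrite l_neq0.
Qed.

(** Otherwise [l^4] would divide [alpha^2 - 3 beta], which is the unit [c4]. *)
Lemma scaling_unit_c4 : c4 W != 0 -> (c4 W)^-1 \in Zl ->
  u \in Zl /\ u^-1 \in Zl.
Proof.
move=> c0 lc; apply: scaling_unit => y z ly lz a_eq b_eq.
case/negP: (local_ring_prime_inv l_prime).
have -> : l%:R^-1 = l%:R ^+ 3 * (y ^+ 2 - 3 * z) * (c4 W)^-1.
  apply: (mulIf c0); rewrite divfK // -(c4_alpha_beta W x) a_eq b_eq.
  by field.
by local.
Qed.

(** Otherwise [l^12] would divide [2^8] times a unit, impossible even at [l = 2] because 8 < 12. *)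
Lemma scaling_unit_good : good_reduction l W -> u \in Zl /\ u^-1 \in Zl.
Proof.
move=> /(good_reduction_unit l_prime Wl)[d0 ld].
apply: scaling_unit => y z ly lz a_eq b_eq.
have l12 : (l%:Z ^+ 12 %| 2 ^+ 8)%Z.
  rewrite -(local_ring_dvd l_prime).
  have e : 2 ^+ 8 * discriminant W = l%:R ^+ 12 * (z ^+ 2 * (y ^+ 2 - 4 * z)).
    by rewrite -(discriminant_alpha_beta Wx) a_eq b_eq; ring.
  have -> : (2 ^+ 8)%:~R / l%:R ^+ 12
            = z ^+ 2 * (y ^+ 2 - 4 * z) * (discriminant W)^-1.
    rewrite rmorphXn rmorph_nat; move: (2 ^+ 8 : rat) (z ^+ 2 * _) e => c k e.
    by apply/eqP; rewrite eqr_div ?expf_neq0 // e mulrC.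
  by local.
have l2 : l = 2.
  have : (l%:Z %| 2 ^+ 8)%Z by apply: dvdz_trans l12; apply: dvdz_exp.
  by rewrite dvdzE abszX Euclid_dvdX // andbT dvdn_prime2 // => /eqP.
by move: l12; rewrite l2 dvdz_Pexp2l.
Qed.

Lemma good_model : odd l -> good_reduction l W -> ~~ (l%:Z %| D)%Z.
Proof.
move=> l_odd W_good; have [lu lui] := scaling_unit_good W_good.
have [d0 ld] := good_reduction_unit l_prime Wl W_good.
have D0 : D != 0.
  rewrite -(intr_eq0 rat) D_eq.
  by apply: mulf_neq0; [|apply: mulf_neq0 d0]; apply: expf_neq0.
have l2 : 2^-1 \in Zl.
  rewrite -[2]/(2%:~R) (local_ring_unitE l_prime) // dvdzE /= dvdn_prime2 //.
  by apply: contraTneq l_odd => ->.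
rewrite -(local_ring_unitE l_prime) // D_eq (invfM (u ^+ 12)).
by rewrite (invfM (2 ^+ 8)) -!exprVn; local.
Qed.

(** Both [u] and the discriminant are 2-adic units, so the factor [2^8] alone gives the valuation;
    the condition on [c4] passes through the unit [u^4]. *)
Lemma good_model2 : l = 2 -> good_reduction l W ->
  [/\ (2 ^+ 8 %| D)%Z, ~~ (2 ^+ 9 %| D)%Z & (4 %| C)%Z -> (8 %| C)%Z].
Proof.
move=> l2 W_good; have [lu lui] := scaling_unit_good W_good.
have [d0 ld] := good_reduction_unit l_prime Wl W_good.
have [ldisc _] := residue_discriminant l_prime Wl.
have lE : l%:R = 2 :> rat by rewrite l2.
have lZ : l%:Z = 2 by rewrite l2.
have dvd2X (m : int) k : (2 ^+ k %| m)%Z = (m%:~R / 2 ^+ k \in Zl).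
  by rewrite -lZ -lE local_ring_dvd.
have dvd4 m : (4 %| m)%Z = (m%:~R / 2 ^+ 2 \in Zl) := dvd2X m 2.
have dvd8 m : (8 %| m)%Z = (m%:~R / 2 ^+ 3 \in Zl) := dvd2X m 3.
rewrite !dvd2X dvd4 dvd8 D_eq C_eq; split.
- have -> : u ^+ 12 * (2 ^+ 8 * discriminant W) / 2 ^+ 8
            = u ^+ 12 * discriminant W.
    by move: (discriminant W) => d; field.
  by local.
- apply/negP => lD; case/negP: (local_ring_prime_inv l_prime).
  have -> : l%:R^-1 = u ^+ 12 * (2 ^+ 8 * discriminant W) / 2 ^+ 9
                      * u^-1 ^+ 12 * (discriminant W)^-1.
    by rewrite lE; move: (discriminant W) d0 => d d0; field; rewrite d0 u_neq0.
  by local.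
- have -> : u ^+ 4 * c4 W / 2 ^+ 2 = u ^+ 4 * (c4 W / 4).
    by move: (c4 W) => c; field.
  have -> : u ^+ 4 * c4 W / 2 ^+ 3 = u ^+ 4 * (c4 W / 8).
    by move: (c4 W) => c; field.
  move=> lC; rewrite rpredM ?rpredX // (local_c4_mod8 l2 Wl) //.
  by rewrite -[c4 W / 4](mulKf (expf_neq0 4 u_neq0)) -exprVn; local.
Qed.

Lemma multiplicative_model : odd l -> multiplicative_reduction l W ->
  (l%:Z %| D)%Z /\ ~~ (l%:Z %| C)%Z.
Proof.
move=> l_odd W_mult.
have [ld [c0 lc]] := multiplicative_reduction_local l_prime l_odd Wl W_mult.
have [lu lui] := scaling_unit_c4 c0 lc; split.
  rewrite -[l%:Z]expr1 -(local_ring_dvd l_prime) D_eq expr1.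
  by rewrite -!mulrA; local.
have C0 : C != 0 by rewrite -(intr_eq0 rat) C_eq mulf_neq0 ?expf_neq0.
by rewrite -(local_ring_unitE l_prime) // C_eq (invfM (u ^+ 4)) -exprVn; local.
Qed.

End LocalModel.

Lemma integral_model (p q : nat) (E : elliptic_curve rat) :
  prime p -> prime q -> odd p -> odd q -> p <> q ->
  is_conductor E (p * q) -> has_rational_point_of_order_2 E ->
  exists A B : int,
    let D := B ^+ 2 * (A ^+ 2 - 4 * B) in let C := A ^+ 2 - 3 * B in
    [/\ forall l, prime l -> l \notin [:: 2; p; q] -> ~~ (l%:Z %| D)%Z,
        forall l, l \in [:: p; q] -> (l%:Z %| D)%Z /\ ~~ (l%:Z %| C)%Z
      & [/\ (2 ^+ 8 %| D)%Z, ~~ (2 ^+ 9 %| D)%Z & (4 %| C)%Z -> (8 %| C)%Z]].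
Proof.
move=> p_prime q_prime p_odd q_odd p_neq_q [_ E_cond].
have odd_pq l : l \in [:: p; q] -> prime l /\ odd l.
  by rewrite !inE => /orP[]/eqP->.
have two_pq : 2 \in [:: p; q] = false by apply/negP => /odd_pq[].
have logE l : logn l (p * q) = ((l == p) + (l == q))%N.
  by rewrite lognM ?prime_gt0 // !logn_prime.
case/order2_abscissa_exists=> x Ex.
have b0 : beta E x != 0.
  apply: contraNneq (discriminant_neq0 E) => b0.
  have /eqP := discriminant_alpha_beta Ex.
  by rewrite b0 expr0n mul0r eq_sym mulf_eq0.
have [u [A [B [u0 A_eq B_eq AB_min]]]] := rat_minimal_pair (alpha E x) b0.
(* One pair [(A, B)] serves all primes: passing to an [l]-minimal equation only changes the scaling
   factor. *)
have model l : prime l -> exists (W : weierstrass rat) (x' u' : rat),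
    [/\ p_integral_equation l W /\ order2_abscissa W x', u' != 0,
        A%:~R = u' ^+ 2 * alpha W x', B%:~R = u' ^+ 4 * beta W x'
      & if l \in [:: p; q] then multiplicative_reduction l W
        else good_reduction l W].
  move=> l_prime; have [W [[v [r [s [t [v0 W_eq]]]]] Wl _] W_red] :=
    E_cond l l_prime.
  subst W; have [x' [Wx' a_eq b_eq]] := change_variables_order2 r s t v0 Ex.
  exists (change_variables v r s t E), x', (u * v); split.
  - by split.
  - exact: mulf_neq0.
  - by rewrite A_eq a_eq exprMn mulrA.
  - by rewrite B_eq b_eq exprMn mulrA.
  (* The exponent of [l] in [p q] is at most 1, while additive reduction requires at least 2. *)
  move: W_red; rewrite logE !inE; have [->|_] := eqVneq l p.
    by rewrite (introF eqP p_neq_q) /= => -[[]|[]|[_ []]].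
  by case: (l == q) => /= -[[]|[]|[_ []]].
exists A, B; split.
- move=> l l_prime; rewrite !inE negb_or => /andP[l2 lpq].
  have [W [x' [u' [[Wl Wx'] u0' A_eq' B_eq']]]] := model l l_prime.
  rewrite !inE (negPf lpq) => W_good.
  have l_odd : odd l by case: (even_prime l_prime) l2 => // ->.
  exact: good_model Wl Wx' u0' A_eq' B_eq' AB_min l_odd W_good.
- move=> l lpq; have [l_prime l_odd] := odd_pq l lpq.
  have [W [x' [u' [[Wl Wx'] u0' A_eq' B_eq']]]] := model l l_prime.
  rewrite lpq => W_mult.
  exact: multiplicative_model Wl Wx' u0' A_eq' B_eq' AB_min l_odd W_mult.
- have [W [x' [u' [[Wl Wx'] u0' A_eq' B_eq']]]] := model 2 isT.
  rewrite two_pq => W_good.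
  exact: good_model2 Wl Wx' u0' A_eq' B_eq' AB_min erefl W_good.
Qed.

(** * The Diophantine equations *)

Lemma PoszX (m n : nat) : Posz (m ^ n) = m%:Z ^+ n.
Proof. by rewrite -!natz natrX. Qed.

Lemma pq_factorization (p q : nat) (n : int) : prime p -> prime q -> p != q ->
  n != 0 -> (forall l, prime l -> (l%:Z %| n)%Z -> l \in [:: p; q]) ->
  exists s : bool,
    n = (-1) ^+ s * (p%:Z ^+ logn p `|n| * q%:Z ^+ logn q `|n|).
Proof.
move=> p_prime q_prime p_neq_q n0 n_pq; exists (n < 0)%R.
rewrite {1}[n]intEsign; congr (_ * _); rewrite -!PoszX -PoszM; congr Posz.
have n_gt0 : (0 < `|n|)%N by rewrite absz_gt0.
rewrite -{1}(partnC p n_gt0) p_part; congr (_ * _)%N.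
(* Only [p] and [q] divide [n], so its part prime to [p] is its [q]-part. *)
rewrite -p_part; apply: eq_in_partn => l.
rewrite mem_primes => /and3P[l_prime _ ln].
have := n_pq l l_prime ln; rewrite !inE => /orP[]/eqP->.
  by rewrite eqxx /= (negPf p_neq_q).
by rewrite eqxx eq_sym p_neq_q.
Qed.

(** Since [p] divides [m], coprimality makes [n] a divisor of [q^b]; as [n > 1], it takes [q] away
    from [m]. *)
Lemma coprime_factors_prime_powers (p q a b m n : nat) :
  prime p -> prime q -> coprime m n -> (1 < n)%N ->
  (m * n = p ^ a * q ^ b)%N -> (p %| m)%N -> m = (p ^ a)%N /\ n = (q ^ b)%N.
Proof.
move=> p_prime q_prime mn n_gt1 mn_eq pm.
have pn : coprime p n by apply: coprime_dvdl mn.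
have nq : (n %| q ^ b)%N.
  rewrite -(@Gauss_dvdr _ (p ^ a)) -?mn_eq ?dvdn_mull //.
  by rewrite coprime_sym coprimeXl.
have qn : (q %| n)%N.
  have /(dvdn_pfactor _ _ q_prime)[[|j] _ n_eq] := nq.
    by rewrite n_eq in n_gt1.
  by rewrite n_eq expnS dvdn_mulr.
have mq : coprime m q by apply: coprime_dvdr mn.
split; apply/eqP; rewrite eqn_dvd ?nq /=.
  rewrite -(@Gauss_dvdl _ _ (q ^ b)) ?coprimeXr // -mn_eq dvdn_mulr //=.
  by rewrite -(@Gauss_dvdl _ _ n) ?coprimeXl // mn_eq dvdn_mulr.
rewrite -(@Gauss_dvdr _ m); last by rewrite coprime_sym coprimeXr.
by rewrite mn_eq dvdn_mull.
Qed.

Lemma square_minus_64 (p q a b z : nat) (s : bool) :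
  prime p -> prime q -> odd p -> odd q -> p != q ->
  (p * q)%N \notin [:: 15; 21; 39; 55] -> (0 < a)%N -> (0 < b)%N ->
  z%:Z ^+ 2 - 64 = (-1) ^+ s * (p%:Z ^+ a * q%:Z ^+ b) ->
  `|p%:Z ^+ a - q%:Z ^+ b| = 16.
Proof.
move=> p_prime q_prime p_odd q_odd p_neq_q N_exc a0 b0.
rewrite -!PoszX -PoszM; set n := (p ^ a * q ^ b)%N => z_eq0.
have {z_eq0} z_eq : (if s then z ^ 2 + n = 64 else z ^ 2 = n + 64)%N.
  by case: s z_eq0 => /=; rewrite ?expr1 ?mulN1r ?expr0 ?mul1r; lia.
have pn : (p %| n)%N by rewrite dvdn_mulr // dvdn_exp.
have qn : (q %| n)%N by rewrite dvdn_mull // dvdn_exp.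
have n_odd : odd n by rewrite oddM !oddX p_odd q_odd !orbT.
have n_gt0 : (0 < n)%N by rewrite odd_gt0.
have z_odd : odd z.
  apply: contraTT n_odd => /negPf z_even.
  have : odd (z ^ 2) = odd n by case: s z_eq; lia.
  by rewrite oddX z_even => <-.
(* Beyond 9 the smaller factor [z - 8] exceeds 1. The odd values up to 9 give [n] = 63, 55, 39, 15,
   whose radicals are the excluded conductors, and 17, which has only one prime factor. *)
have [z_le9|z_gt9] := leqP z 9.
  have rad r t : primes n = [:: r; t] -> (p * q)%N = (r * t)%N.
    have : p \in primes n by rewrite mem_primes p_prime n_gt0.
    have : q \in primes n by rewrite mem_primes q_prime n_gt0.
    move=> qP pP n_eq; move: qP pP p_neq_q; rewrite n_eq !inE.
    by move=> /orP[]/eqP-> /orP[]/eqP->; rewrite ?eqxx // mulnC.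
  case/negP: N_exc; move: z_le9 z_odd z_eq {n_odd}.
  do 10?[case: z => [|z] //] => _ _ z_eq.
  - by have n_eq : n = 63 by [case: s z_eq; lia]; rewrite (rad 3 7) ?n_eq.
  - by have n_eq : n = 55 by [case: s z_eq; lia]; rewrite (rad 5 11) ?n_eq.
  - by have n_eq : n = 39 by [case: s z_eq; lia]; rewrite (rad 3 13) ?n_eq.
  - by have n_eq : n = 15 by [case: s z_eq; lia]; rewrite (rad 3 5) ?n_eq.
  - have n_eq : n = 17 by [case: s z_eq; lia].
    move: pn qn p_neq_q; rewrite n_eq !dvdn_prime2 // => /eqP-> /eqP->.
    by rewrite eqxx.
(* The negative sign would force [z^2 < 64]. *)
have z_eq' : ((z - 8) * (z + 8) = n)%N.
  by case: s z_eq => /=; nia.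
(* Two odd numbers differing by [2^4] are coprime. *)
have cop : coprime (z - 8) (z + 8).
  have -> : (z + 8 = (z - 8) + 2 ^ 4)%N by lia.
  by rewrite /coprime gcdnDl -/(coprime _ _) coprimeXr // coprimen2; lia.
have : (p %| z - 8)%N || (p %| z + 8)%N by rewrite -Euclid_dvdM // z_eq'.
case/orP=> pz.
  have [|<- <-] := coprime_factors_prime_powers p_prime q_prime cop _ z_eq' pz;
    lia.
rewrite mulnC in z_eq'; rewrite coprime_sym in cop.
have [|<- <-] := coprime_factors_prime_powers p_prime q_prime cop _ z_eq' pz;
  lia.
Qed.

Lemma coprime_parts_solvable (p q : nat) (A X Y : int) :
  prime p -> prime q -> odd p -> odd q -> p != q ->
  (p * q)%N \notin [:: 15; 21; 39; 55] ->
  X != 0 -> Y != 0 ->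
  (forall l, prime l -> (l%:Z %| X * Y)%Z -> l \in [:: p; q]) ->
  (forall l, l \in [:: p; q] -> (l%:Z %| X)%Z = ~~ (l%:Z %| Y)%Z) ->
  A ^+ 2 - X = 64 * Y ->
  equation_solvable p q \/ equation_solvable q p.
Proof.
move=> p_prime q_prime p_odd q_odd p_neq_q N_exc X0 Y0 XY_pq XorY A_eq.
have [|s X_eq] := pq_factorization p_prime q_prime p_neq_q X0.
  by move=> l l_prime lX; apply: XY_pq => //; apply: dvdz_mulr.
have [|t Y_eq] := pq_factorization p_prime q_prime p_neq_q Y0.
  by move=> l l_prime lY; apply: XY_pq => //; apply: dvdz_mull.
have log_gt0 l (n : int) : prime l -> n != 0 ->
    (0 < logn l `|n|)%N = (l%:Z %| n)%Z.
  by move=> l_prime n0; rewrite logn_gt0 mem_primes l_prime absz_gt0 n0.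
have pX := XorY p (mem_head _ _); have qX : (q%:Z %| X)%Z = ~~ (q%:Z %| Y)%Z.
  by apply: XorY; rewrite !inE eqxx orbT.
rewrite -!log_gt0 // in pX qX.
move: (logn p `|X|) (logn q `|X|) (logn p `|Y|) (logn q `|Y|) pX qX X_eq Y_eq.
move=> a b c d.
case: (posnP c) => [->|c0]; case: (posnP d) => [->|d0] /= a0 b0 X_eq Y_eq.
(* Both primes divide [X] and [Y] is a sign: -1 gives equation (3), where [X = A^2 + 64] is
   positive, and 1 gives equation (2). *)
- rewrite !expr0 !mulr1 in Y_eq.
  case: t Y_eq => Y_eq; rewrite Y_eq ?mulr1 ?mulrN1 in A_eq.
    left; exists A, a, b; do 2?split=> //; right; right; left.
    case: s X_eq => X_eq; last by rewrite mul1r in X_eq; lia.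
    rewrite mulN1r in X_eq.
    have : 0 <= A ^+ 2 by rewrite sqr_ge0.
    have : 0 <= p%:Z ^+ a * q%:Z ^+ b by rewrite mulr_ge0 ?exprn_ge0.
    lia.
  left; exists A, a, b; do 2?split=> //; right; left.
  apply: (@square_minus_64 p q a b `|A| s) => //.
  by rewrite abszE real_normK ?num_real // -X_eq; lia.
(* One prime in each of [X] and [Y]: equation (4), here and, with [p] and [q] interchanged, in the
   next case. *)
- have {b0} b0 : b = 0%N by lia.
  rewrite b0 in X_eq.
  left; exists A, a, d; do 2?split=> //; do 3!right; left; exists (~~ t), s.
  rewrite !expr0 ?mulr1 ?mul1r in X_eq Y_eq.
  rewrite -X_eq.
  have -> : (-1) ^+ (~~ t) * (64 * q%:Z ^+ d) = - (64 * Y).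
    by rewrite Y_eq; case: t {Y_eq}; ring.
  lia.
- have {a0} a0 : a = 0%N by lia.
  rewrite a0 in X_eq.
  right; exists A, b, c; do 2?split=> //; do 3!right; left; exists (~~ t), s.
  rewrite !expr0 ?mulr1 ?mul1r in X_eq Y_eq.
  rewrite -X_eq.
  have -> : (-1) ^+ (~~ t) * (64 * p%:Z ^+ c) = - (64 * Y).
    by rewrite Y_eq; case: t {Y_eq}; ring.
  lia.
(* Both primes divide [Y] and [X] is a sign: equation (7). *)
- have {a0} a0 : a = 0%N by lia.
  rewrite a0 in X_eq.
  have {b0} b0 : b = 0%N by lia.
  rewrite b0 in X_eq.
  left; exists A, c, d; do 2?split=> //; do 6!right; exists (~~ t), s.
  rewrite !expr0 ?mulr1 in X_eq.
  rewrite -X_eq.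
  have -> : (-1) ^+ (~~ t) * (64 * p%:Z ^+ c * q%:Z ^+ d) = - (64 * Y).
    by rewrite Y_eq; case: t {Y_eq}; ring.
  lia.
Qed.

(** * Analysis at the prime 2 *)

Lemma dvd2_sqrz (A : int) : (2 %| A ^+ 2)%Z -> exists A', A = 2 * A'.
Proof.
rewrite dvdzE abszX Euclid_dvdX // andbT => /(@dvdzP 2 A)[A' ->].
by exists A'; rewrite mulrC.
Qed.

Lemma two_adic_split (n : int) : n != 0 ->
  exists k n', n = 2 ^+ k * n' /\ ~~ (2 %| n')%Z.
Proof.
move=> n0; have n_gt0 : (0 < `|n|)%N by rewrite absz_gt0.
have [m m_odd n_eq] := pfactor_coprime (isT : prime 2) n_gt0.
move: (logn 2 `|n|) n_eq => k n_eq; exists k, ((-1) ^+ (n < 0)%R * m%:Z); split.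
  by rewrite [LHS]intEsign n_eq PoszM PoszX mulrA mulrC.
by rewrite dvdzE abszMsign -(@prime_coprime 2).
Qed.

(* The last hypothesis says that c4 is not 4 modulo 8, as good reduction at 2
   implies; it excludes k = 2 and k = 3. *)
Lemma two_adic_cases_odd (A B D : int) (k m : nat) :
  ~~ (2 %| B)%Z -> ~~ (2 %| D)%Z -> (k * 2 + m = 8)%N ->
  A ^+ 2 - 4 * (2 ^+ k * B) = 2 ^+ m * D ->
  ((4 %| A ^+ 2 - 3 * (2 ^+ k * B))%Z -> (8 %| A ^+ 2 - 3 * (2 ^+ k * B))%Z) ->
  exists A' : int, A' ^+ 2 - B = 64 * D \/ A' ^+ 2 - D = 64 * B.
Proof.
have half (x c : int) : x ^+ 2 = 2 * c -> exists x', x = 2 * x'.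
  by move=> x_eq; apply: dvd2_sqrz; rewrite x_eq dvdz_mulr.
have even (x c : int) : x = 2 * c -> (2 %| x)%Z by move=> ->; rewrite dvdz_mulr.
have div4 (x c : int) : x = 4 * c -> (4 %| x)%Z by move=> ->; rewrite dvdz_mulr.
have div8 (x : int) : (8 %| x)%Z -> exists c, x = c * 8 by move/dvdzP.
case: k => [|[|[|[|[|k]]]]] B_odd D_odd.
- move=> km; have -> : m = 8%N by lia.
  move=> E_eq _; have [|A' A_eq] := half A (2 ^+ 7 * D + 2 * B); first by lra.
  by exists A'; left; rewrite A_eq in E_eq; lra.
(* For [k = 1], [A^2 = 8 (8 D + B)] with [B] odd would have odd valuation 3. *)
- move=> km; have -> : m = 6%N by lia.
  move=> E_eq _.
  have [|A1 A_eq] := half A (32 * D + 4 * B); first by lra.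
  rewrite A_eq in E_eq; have [|A2 A1_eq] := half A1 (8 * D + B); first by lra.
  rewrite A1_eq in E_eq; case/negP: B_odd.
  by apply: (even _ (A2 ^+ 2 - 4 * D)); lra.
(* For [k = 2], [A = 4 A2], so [c4] becomes [4 (4 A2^2 - 3 B)], which is 4 modulo 8. *)
- move=> km; have -> : m = 4%N by lia.
  move=> E_eq C48.
  have [|A1 A_eq] := half A (8 * D + 8 * B); first by lra.
  rewrite A_eq in E_eq.
  have [|A2 A1_eq] := half A1 (2 * D + 2 * B); first by lra.
  rewrite A_eq A1_eq in C48; case/negP: B_odd.
  have [|c C_eq] := div8 _ (C48 _).
    by apply: (div4 _ (4 * A2 ^+ 2 - 3 * B)); ring.
  by apply: (even _ (2 * A2 ^+ 2 - c - B)); lra.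
(* For [k = 3], [A = 2 A1] with [A1^2 = D + 8 B] odd, so [c4] becomes [4 (A1^2 - 6 B)], again 4
   modulo 8. *)
- move=> km; have -> : m = 2%N by lia.
  move=> E_eq C48.
  have [|A1 A_eq] := half A (2 * D + 16 * B); first by lra.
  rewrite A_eq in C48 E_eq; case/negP: D_odd.
  have [|c C_eq] := div8 _ (C48 _).
    by apply: (div4 _ (A1 ^+ 2 - 6 * B)); ring.
  by apply: (even _ (c - B)); lra.
- move=> km; have -> : m = 0%N by lia.
  by move=> E_eq _; exists A; right; lra.
- by lia.
Qed.

Lemma two_adic_cases (A B : int) (D := B ^+ 2 * (A ^+ 2 - 4 * B)) :
  (2 ^+ 8 %| D)%Z -> ~~ (2 ^+ 9 %| D)%Z ->
  ((4 %| A ^+ 2 - 3 * B)%Z -> (8 %| A ^+ 2 - 3 * B)%Z) ->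
  exists A' B' D' : int,
    [/\ ~~ (2 %| B' * D')%Z, D = 2 ^+ 8 * (B' ^+ 2 * D'),
        exists k m, B = 2 ^+ k * B' /\ A ^+ 2 - 4 * B = 2 ^+ m * D'
      & A' ^+ 2 - B' = 64 * D' \/ A' ^+ 2 - D' = 64 * B'].
Proof.
move=> D8 D9 C48.
have D0 : D != 0 by apply: contraNneq D9 => ->; rewrite dvdz0.
have := D0; rewrite mulf_eq0 expf_eq0 negb_or /= => /andP[B0 E0].
have [k [B' [B_eq B'_odd]]] := two_adic_split B0.
have [m [D' [E_eq D'_odd]]] := two_adic_split E0; have E_eq0 := E_eq.
have odd2M x y : ~~ (2 %| x)%Z -> ~~ (2 %| y)%Z -> ~~ (2 %| x * y)%Z.
  by move=> x_odd y_odd; rewrite dvdzE abszM Euclid_dvdM // negb_or x_odd.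
have BD_odd : ~~ (2 %| B' ^+ 2 * D')%Z by rewrite !odd2M.
have D_eq : D = 2 ^+ (k * 2 + m) * (B' ^+ 2 * D').
  by rewrite /D E_eq B_eq exprMn -exprM exprD mulrACA.
have dvdD j : (2 ^+ j %| D)%Z = (j <= k * 2 + m)%N.
  apply/idP/idP => [|le_j]; last by rewrite D_eq dvdz_mulr // dvdz_exp2l.
  rewrite D_eq Gauss_dvdzl ?dvdz_Pexp2l //.
  by rewrite coprimezE abszX coprimeXl // prime_coprime.
rewrite !dvdD in D8 D9; have km : (k * 2 + m = 8)%N by lia.
rewrite B_eq in E_eq C48.
have [A' A'_eq] := two_adic_cases_odd B'_odd D'_odd km E_eq C48.
exists A', B', D'; split.
- exact: odd2M.
- by rewrite D_eq km.
- by exists k, m; rewrite E_eq0.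
- by [].
Qed.

(** * Combination of the local information at 2, [p] and [q] *)

Lemma conductor_pq_solvable (p q : nat) (E : elliptic_curve rat) :
  prime p -> prime q -> odd p -> odd q -> p <> q ->
  (p * q)%N \notin [:: 15; 21; 39; 55] ->
  is_conductor E (p * q) -> has_rational_point_of_order_2 E ->
  equation_solvable p q \/ equation_solvable q p.
Proof.
move=> p_prime q_prime p_odd q_odd p_neq_q N_exc E_cond E_2.
have [A [B []]] :=
  integral_model p_prime q_prime p_odd q_odd p_neq_q E_cond E_2.
move=> D_pq pq_D [D8 D9 C48].
have [A' [B' [D' [BD_odd D_eq [k [m [B_eq E_eq]]] A'_eq]]]] :=
  two_adic_cases D8 D9 C48.
have BD0 : B' * D' != 0 by apply: contraNneq BD_odd => ->.
have := BD0; rewrite mulf_eq0 negb_or => /andP[B0 D0].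
have BD_pq l : prime l -> (l%:Z %| B' * D')%Z -> l \in [:: p; q].
  move=> l_prime lBD; apply/negPn/negP => l_pq.
  have l_out : l \notin [:: 2; p; q].
    by rewrite in_cons negb_or l_pq andbT; apply: contraNneq BD_odd => l2;
      rewrite l2 in lBD.
  case/negP: (D_pq l l_prime l_out).
  by rewrite D_eq dvdz_mull // expr2 -mulrA dvdz_mull.
have BorD l : l \in [:: p; q] -> (l%:Z %| B')%Z = ~~ (l%:Z %| D')%Z.
  move=> l_pq; have [lD lC] := pq_D l l_pq.
  have [l_prime l_odd] : prime l /\ odd l.
    by move: l_pq; rewrite !inE => /orP[]/eqP->.
  have l_neq2 : l != 2 by apply: contraTneq l_odd => ->.
  have : (l%:Z %| B')%Z || (l%:Z %| D')%Z.
    move: lD; rewrite D_eq !dvdzE !(abszX, abszM).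
    rewrite !(Euclid_dvdX, Euclid_dvdM) // !andbT dvdn_prime2 //.
    by rewrite [_ == _](negbTE l_neq2).
  (* A prime dividing both [B'] and [D'] would divide [A^2 - 3 B], the sum of [A^2 - 4 B] and
     [B]. *)
  case: (boolP (_ %| D')%Z) => [lD' _|_]; last by rewrite orbF.
  apply/negbTE; apply: contra lC => lB'.
  have -> : A ^+ 2 - 3 * B = (A ^+ 2 - 4 * B) + B by ring.
  by rewrite E_eq [in X in _ + X]B_eq rpredD // dvdz_mull.
have p_neq_q' : p != q by apply/eqP.
(* The two 2-adic cases differ only in which of [B'] and [D'] plays the role of [X]. *)
case: A'_eq => A'_eq.
  exact: coprime_parts_solvable B0 D0 BD_pq BorD A'_eq.
apply: coprime_parts_solvable D0 B0 _ _ A'_eq => // l.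
  by rewrite mulrC; apply: BD_pq.
by move=> l_pq; rewrite BorD ?negbK.
Qed.

Local Close Scope ring_scope.

Theorem theorem5 (p q N : nat)
  (p_prime : prime p) (q_prime : prime q) (p_odd : odd p) (q_odd : odd q)
  (p_neq_q : p <> q) (N_eq : N = (p * q)%N)
  (N_exc : N \notin [:: 15; 21; 39; 55])
  (HE : exists E : elliptic_curve rat,
          is_conductor E N /\ has_rational_point_of_order_2 E) :
  equation_solvable p q \/ equation_solvable q p.
Proof.
case: HE => E [E_cond E_2]; rewrite N_eq in E_cond N_exc.
exact: conductor_pq_solvable E_cond E_2.
Qed.
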